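(* Let $\kappa>0$ and $\lambda\in\mathbb C\setminus\{0\}$. For every finite interval $\Lambda\subset\mathbb Z$ with $|\Lambda|\ge8$ or $|\Lambda|\in\{5,6\}$, $\ker H_\Lambda=\mathcal G_\Lambda$. For $|\Lambda|=7$, $\ker H_\Lambda=\mathcal G_\Lambda\oplus\operatorname{span}\{|1100011\rangle\}$.
   Context: $\mathcal H_\Lambda=\bigotimes_{x\in\Lambda}\mathbb C^2$ with basis $|1\rangle,|0\rangle$ per site and product basis $|\boldsymbol\sigma\rangle$; $n_x=|1\rangle\langle1|_x$, $\sigma^-_x=|0\rangle\langle1|_x$. For $\Lambda=[a,b]$, $H_\Lambda=\sum_{x=a}^{b-2}n_xn_{x+2}+\kappa\sum_{x=a}^{b-3}q_x^*q_x$ with $q_x=\sigma^-_{x+1}\sigma^-_{x+2}-\lambda\sigma^-_x\sigma^-_{x+3}$. Tiles occupy consecutive sites and carry 0/1 words: void $0$; monomer $100$; dimer $011000$; left boundary dimer $11000$ (only as first tile); and, only as last tile: right dimer $011$, right 1-monomer $1$, right 2-monomer $10$, truncated 1-dimer $0110$, truncated 2-dimer $01100$. A root tiling $R$ of $\Lambda$ is a tiling by consecutive voids and monomers, optionally with a left boundary dimer as first tile and optionally with one of right dimer, right 1-monomer, right 2-monomer as last tile; $\mathcal R_\Lambda$ is their set. A VMD tiling derived from $R$ is obtained by choosing disjoint pairs of consecutive tiles of $R$, each either two monomers (replaced by a dimer) or a monomer followed by a right $j$-monomer, $j\in\{1,2\}$ (replaced by the truncated $j$-dimer); $\mathcal D_\Lambda(R)$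 is their set, $\boldsymbol\sigma_\Lambda(\mathbf D)$ the concatenated content, $\#(\mathbf D)$ the number of tiles that are dimers, boundary dimers or truncated dimers, $\psi_\Lambda(R)=\sum_{\mathbf D\in\mathcal D_\Lambda(R)}\lambda^{\#(\mathbf D)}|\boldsymbol\sigma_\Lambda(\mathbf D)\rangle$ and $\mathcal G_\Lambda=\operatorname{span}\{\psi_\Lambda(R):R\in\mathcal R_\Lambda\}$. *)

(* Defs.v *)
From HB Require Import structures.
From mathcomp Require Import all_boot all_order all_algebra.
Set Implicit Arguments. Unset Strict Implicit. Unset Printing Implicit Defensive.
Import GRing.Theory Num.Theory.
Local Open Scope ring_scope.

(* Conventions: the interval Lambda = [a,b] is relabelled as sites 0..n-1,
   n = |Lambda| (all definitions are translation invariant).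
   A product basis vector |sigma> is an n-tuple of booleans, true = |1>, false = |0>.
   Vectors of H_Lambda are functions cfg n -> C; operators are kernels
   cfg n -> cfg n -> C (matrix elements <tau| A |sigma>). *)

Definition cfg (n : nat) := (n.-tuple bool).
Definition site n (s : cfg n) (x : nat) : bool := nth false s x.

Section Ops.
Variable C : numClosedFieldType.
Variable n : nat.

Definition op := cfg n -> cfg n -> C.

Definition embed1 (x : nat) (A : bool -> bool -> C) : op :=
  fun t s => A (site t x) (site s x) *
    ([forall i : 'I_n, (val i != x) ==> (tnth t i == tnth s i)] : nat)%:R.

Definition comp (A B : op) : op := fun t s => \sum_(r : cfg n) A t r * B r s.
Definition adj (A : op) : op := fun t s => (A s t)^*.

Definition nmat : bool -> bool -> C := fun b b' => ((b && b') : nat)%:R.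
Definition smin : bool -> bool -> C := fun b b' => ((~~ b && b') : nat)%:R.

Definition nn (x : nat) : op := comp (embed1 x nmat) (embed1 (x + 2) nmat).
Definition qop (lam : C) (x : nat) : op := fun t s =>
  comp (embed1 (x + 1) smin) (embed1 (x + 2) smin) t s
  - lam * comp (embed1 x smin) (embed1 (x + 3) smin) t s.

Definition Ham (kappa lam : C) : op := fun t s =>
  \sum_(0 <= x < n - 2) nn x t s
  + kappa * \sum_(0 <= x < n - 3) comp (adj (qop lam x)) (qop lam x) t s.

Definition apply_op (A : op) (psi : {ffun cfg n -> C}) : {ffun cfg n -> C} :=
  [ffun t => \sum_(s : cfg n) A t s * psi s].

Definition in_ker (kappa lam : C) (psi : {ffun cfg n -> C}) : Prop :=
  apply_op (Ham kappa lam) psi = 0.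

Definition vscale (a : C) (f : {ffun cfg n -> C}) : {ffun cfg n -> C} :=
  [ffun t => a * f t].

Definition ket (s : seq bool) : {ffun cfg n -> C} :=
  [ffun t : cfg n => ((val t == s) : nat)%:R].

End Ops.

Inductive tile : Type :=
| Void | Mono | Dimer | LBDimer | RDimer | RMono1 | RMono2 | Trunc1 | Trunc2.

Definition content (t : tile) : seq bool :=
  match t with
  | Void => [:: false]
  | Mono => [:: true; false; false]
  | Dimer => [:: false; true; true; false; false; false]
  | LBDimer => [:: true; true; false; false; false]
  | RDimer => [:: false; true; true]
  | RMono1 => [:: true]
  | RMono2 => [:: true; false]
  | Trunc1 => [:: false; true; true; false]
  | Trunc2 => [:: false; true; true; false; false]
  end.

Definition tiling_content (T : seq tile) : seq bool := flatten (map content T).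

Definition is_void_or_mono (t : tile) : bool :=
  match t with Void | Mono => true | _ => false end.
Definition is_right_last (t : tile) : bool :=
  match t with RDimer | RMono1 | RMono2 => true | _ => false end.
Definition is_dimerlike (t : tile) : bool :=
  match t with Dimer | LBDimer | Trunc1 | Trunc2 => true | _ => false end.

Definition root_tiling (n : nat) (R : seq tile) : Prop :=
  exists pre mid suf,
    R = pre ++ mid ++ suf /\
    (pre = [::] \/ pre = [:: LBDimer]) /\
    all is_void_or_mono mid /\
    (suf = [::] \/ exists t, suf = [:: t] /\ is_right_last t) /\
    size (tiling_content R) = n.

(* all VMD tilings derived from R: choose disjoint pairs of consecutive tiles
   (monomer,monomer) -> dimer, (monomer, right j-monomer) -> truncated j-dimer *)
Fixpoint derive (R : seq tile) : seq (seq tile) :=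
  match R with
  | [::] => [:: [::]]
  | t :: rest =>
    [seq t :: d | d <- derive rest] ++
    match t, rest with
    | Mono, Mono :: rest' => [seq Dimer :: d | d <- derive rest']
    | Mono, RMono1 :: rest' => [seq Trunc1 :: d | d <- derive rest']
    | Mono, RMono2 :: rest' => [seq Trunc2 :: d | d <- derive rest']
    | _, _ => [::]
    end
  end.

Definition psiR (C : numClosedFieldType) (n : nat) (lam : C) (R : seq tile)
  : {ffun cfg n -> C} :=
  \sum_(D <- derive R) vscale (lam ^+ count is_dimerlike D) (ket C n (tiling_content D)).

Definition in_G (C : numClosedFieldType) (n : nat) (lam : C)
  (psi : {ffun cfg n -> C}) : Prop :=
  exists rs : seq (C * seq tile),
    (forall i, (i < size rs)%N -> root_tiling n (nth (0, [::]) rs i).2) /\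
    psi = \sum_(p <- rs) vscale p.1 (psiR n lam p.2).

(* Main.v *)
(* Positivity of the terms of H turns its kernel into the local conditions
   psi(u1b1v) = 0 and psi(u0110v) = lam psi(u1001v).  The move 0110 -> 1001
   terminates, so a kernel vector is determined by its values on the words
   without 0110; it vanishes on those which have a 1b1, start with 11001 or end
   with 10011 (one reverse move of the latter two creates a 101).  The words
   that remain are exactly the contents of the root tilings, except 1100011,
   where a left boundary dimer 11000 and a right pattern 00011 overlap in their
   three zeros.  Finally psi(R) satisfies the local conditions and the only word
   without 0110 in its support is the content of R, so the kernel vectors
   psi(R) have a prescribed value on each of these words. *)
Require Import Defs.
From HB Require Import structures.
From mathcomp Require Import all_boot all_order all_algebra.
From mathcomp Require Import zify ring.
Import Order.TTheory GRing.Theory Num.Theory.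
Local Open Scope ring_scope.
Set Implicit Arguments. Unset Strict Implicit. Unset Printing Implicit Defensive.

Local Notation "'w1b1' b" := [:: true; b; true] (at level 10).
Local Notation w0110 := [:: false; true; true; false].
Local Notation w1001 := [:: true; false; false; true].
Local Notation w1100011 := [:: true; true; false; false; false; true; true].

(** * Configurations: raising a site, cutting a word into factors *)

Section Configurations.
Variable n : nat.
Implicit Types (s t : cfg n) (x y : nat) (u v w : seq bool).

Lemma cfg_ext s t : (forall x, (x < n)%N -> site s x = site t x) -> s = t.
Proof.
move=> h; apply: eq_from_tnth => i.
by rewrite !(tnth_nth false) -!/(site _ _) h.
Qed.

(** When [t] has a 0 at [x], this is the only [s] with a nonzero matrix element of $\sigma^-_x$ from
    [s] to [t]. *)
Definition raise t x : cfg n := [tuple ((i : nat) == x) || tnth t i | i < n].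

Lemma site_raise t x y : (y < n)%N -> site (raise t x) y = (y == x) || site t y.
Proof.
move=> hy; have := tnth_nth false (raise t x) (Ordinal hy).
by rewrite tnth_mktuple (tnth_nth false) /site => <-.
Qed.

Lemma agree_offP x t s :
  reflect (forall y, (y < n)%N -> y != x -> site t y = site s y)
    [forall i : 'I_n, (val i != x) ==> (tnth t i == tnth s i)].
Proof.
apply: (iffP forallP) => [h y hy yx | h i].
  by have := h (Ordinal hy); rewrite yx /= !(tnth_nth false) => /eqP.
by apply/implyP => ix; rewrite !(tnth_nth false) -!/(site _ _) h.
Qed.

Lemma val_raise t x u a w :
  size u = x -> val t = u ++ a :: w -> val (raise t x) = u ++ true :: w.
Proof.
move=> su vt; have szt : size (u ++ a :: w) = n by rewrite -vt size_tuple.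
apply: (@eq_from_nth _ false); first by rewrite size_tuple -szt !size_cat.
move=> y; rewrite size_tuple => hy.
rewrite -/(site (raise t x) y) site_raise // /site vt !nth_cat -su.
case: ltngtP => //= [h|->]; last by rewrite subnn.
by case E: (y - size u)%N => [|k] //; lia.
Qed.

Lemma cfg_split t x k : (x + k <= n)%N -> exists u w v,
  [/\ size u = x, size w = k & val t = u ++ w ++ v].
Proof.
move=> h; exists (take x t), (take k (drop x t)), (drop k (drop x t)).
rewrite !cat_take_drop size_takel ?size_takel ?size_drop ?size_tuple //; lia.
Qed.

Lemma site_cat t x u w v k :
  size u = x -> val t = u ++ w ++ v -> (k < size w)%N ->
  site t (x + k) = nth false w k.
Proof.
move=> su vt hk; rewrite /site vt nth_cat -su ltnNge leq_addr /= addKn.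
by rewrite nth_cat hk.
Qed.

End Configurations.

(** * From the Hamiltonian to local conditions on amplitudes *)

Section Kernel.
Variables (C : numClosedFieldType) (n : nat).
Implicit Types (s t r : cfg n) (x y : nat) (psi : {ffun cfg n -> C}).

Lemma embed1_nmat x t s : (x < n)%N ->
  embed1 x (@nmat C) t s = (site t x && (s == t))%:R.
Proof.
move=> hx; rewrite /embed1 /nmat -natrM mulnb; congr ((nat_of_bool _)%:R).
apply/idP/idP => [/andP[/andP[tx sx] /agree_offP h]|/andP[tx /eqP ->]].
  rewrite tx; apply/eqP/cfg_ext => y hy.
  by case: (eqVneq y x) => [->|yx]; [rewrite tx sx | rewrite h].
by rewrite tx /=; apply/agree_offP.
Qed.

Lemma embed1_smin x t s : (x < n)%N ->
  embed1 x (@smin C) t s = (~~ site t x && (s == raise t x))%:R.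
Proof.
move=> hx; rewrite /embed1 /smin -natrM mulnb; congr ((nat_of_bool _)%:R).
apply/idP/idP => [/andP[/andP[tx sx] /agree_offP h]|/andP[tx /eqP ->]].
  rewrite tx; apply/eqP/cfg_ext => y hy; rewrite site_raise //.
  by case: (eqVneq y x) => [->|yx]; [rewrite sx | rewrite h].
rewrite tx site_raise // eqxx /=; apply/agree_offP => y hy /negPf yx.
by rewrite site_raise // yx.
Qed.

Lemma sum_pick (P : bool) r (f : cfg n -> C) :
  \sum_s (P && (s == r))%:R * f s = P%:R * f r.
Proof.
rewrite (bigD1 r) //= eqxx andbT big1 ?addr0 // => s /negPf ->.
by rewrite andbF mul0r.
Qed.

Lemma nnE x t s : (x + 2 < n)%N ->
  nn C x t s = ([&& site t x, site t (x + 2) & s == t])%:R.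
Proof.
move=> hx; have hx0 : (x < n)%N by lia.
rewrite /nn /Defs.comp; under eq_bigr => r _ do rewrite !embed1_nmat //.
by rewrite sum_pick -natrM mulnb.
Qed.

Lemma comp_smin x y t s : (x < n)%N -> (y < n)%N -> y != x ->
  Defs.comp (embed1 x (@smin C)) (embed1 y (@smin C)) t s =
  ([&& ~~ site t x, ~~ site t y & s == raise (raise t x) y])%:R.
Proof.
move=> hx hy /negPf yx; rewrite /Defs.comp.
under eq_bigr => r _ do rewrite !embed1_smin //.
by rewrite sum_pick -natrM mulnb site_raise // yx.
Qed.

Lemma apply_qop lam x psi t : (x + 3 < n)%N ->
  apply_op (qop lam x) psi t =
  (~~ site t (x + 1) && ~~ site t (x + 2))%:R
     * psi (raise (raise t (x + 1)) (x + 2))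
  - lam * ((~~ site t x && ~~ site t (x + 3))%:R
     * psi (raise (raise t x) (x + 3))).
Proof.
move=> hx; rewrite ffunE.
under eq_bigr => s _.
  rewrite /qop !comp_smin ?andbA; try by lia.
  rewrite mulrBl -mulrA.
over.
by rewrite /= sumrB -mulr_sumr !sum_pick.
Qed.

Lemma quad_nn x psi : (x + 2 < n)%N ->
  \sum_t (psi t)^* * (\sum_s nn C x t s * psi s) =
  \sum_t (site t x && site t (x + 2))%:R * `|psi t| ^+ 2.
Proof.
move=> hx; apply: eq_bigr => t _.
under eq_bigr => s _ do rewrite nnE // andbA.
by rewrite sum_pick normCK mulrCA [_^* * _]mulrC.
Qed.

Lemma quad_adj (A : op C n) psi :
  \sum_t (psi t)^* * (\sum_s Defs.comp (adj A) A t s * psi s) =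
  \sum_r `|apply_op A psi r| ^+ 2.
Proof.
transitivity (\sum_t \sum_s \sum_r (A r t * psi t)^* * (A r s * psi s)).
  apply: eq_bigr => t _; rewrite mulr_sumr; apply: eq_bigr => s _.
  rewrite mulr_suml mulr_sumr; apply: eq_bigr => r _.
  by rewrite /adj rmorphM /=; ring.
under eq_bigr => t _ do rewrite exchange_big /=.
rewrite exchange_big /=; apply: eq_bigr => r _.
rewrite normCK mulrC ffunE rmorph_sum mulr_suml.
by apply: eq_bigr => t _; rewrite mulr_sumr.
Qed.

Lemma apply_Ham kappa lam psi t :
  apply_op (Ham kappa lam) psi t =
  \sum_(0 <= x < n - 2) (\sum_s nn C x t s * psi s)
  + kappa * \sum_(0 <= x < n - 3)
      (\sum_s Defs.comp (adj (qop lam x)) (qop lam x) t s * psi s).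
Proof.
rewrite ffunE [X in X + _]exchange_big /= [X in _ + _ * X]exchange_big /=.
rewrite mulr_sumr -big_split /=; apply: eq_bigr => s _.
by rewrite /Ham mulrDl -mulrA !mulr_suml.
Qed.

(** The expectation of H in [psi] is a sum of squared moduli with weights 1 and [kappa], so it
    vanishes only if each of them does. *)
Lemma in_ker_local kappa lam psi : 0 < kappa -> in_ker kappa lam psi <->
  (forall x t, (x + 2 < n)%N -> site t x -> site t (x + 2) -> psi t = 0) /\
  (forall x t, (x + 3 < n)%N -> apply_op (qop lam x) psi t = 0).
Proof.
move=> k0; split=> [ker|[h1 h2]]; last first.
  apply/ffunP => t; rewrite apply_Ham ffunE.
  rewrite big_nat big1 ?add0r => [|x hx]; last first.
    under eq_bigr => s _ do [rewrite nnE ?andbA; last by lia].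
    rewrite sum_pick; case: andP => [[tx tx2]|]; last by rewrite mul0r.
    by rewrite (h1 x t) ?mulr0 //; lia.
  rewrite big_nat big1 ?mulr0 // => x hx.
  (* Reassociate $(q^*q)\psi$ as $q^*(q\psi)$, whose inner factor is zero. *)
  transitivity (\sum_r (qop lam x r t)^* * apply_op (qop lam x) psi r).
    under [RHS]eq_bigr => r _ do rewrite ffunE mulr_sumr.
    rewrite exchange_big /=; apply: eq_bigr => s _.
    by rewrite mulr_suml; apply: eq_bigr => r _; rewrite mulrA.
  by rewrite big1 // => r _; rewrite h2 ?mulr0 //; lia.
(* The rest expands the expectation of H into the squares of [quad_nn] and [quad_adj]. *)
have : \sum_t (psi t)^* * apply_op (Ham kappa lam) psi t = 0.
  by rewrite big1 // => t _; rewrite [apply_op _ _]ker ffunE mulr0.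
under eq_bigr => t _ do
  rewrite apply_Ham mulrDr [_^* * (kappa * _)]mulrCA.
rewrite big_split /= -mulr_sumr.
under eq_bigr => t _ do rewrite mulr_sumr.
under [X in _ + _ * X]eq_bigr => t _ do rewrite mulr_sumr.
rewrite exchange_big /=.
rewrite [X in _ + _ * X]exchange_big /= => /eqP.
rewrite big_nat [X in _ + _ * X]big_nat.
under eq_bigr => x hx do [rewrite quad_nn; last by lia].
under [X in _ + _ * X]eq_bigr => x _ do rewrite quad_adj.
have p1 x : 0 <= \sum_t (site t x && site t (x + 2))%:R * `|psi t| ^+ 2.
  by apply: sumr_ge0 => t _; rewrite mulr_ge0 ?exprn_ge0 ?ler0n.
have p2 x : 0 <= \sum_r `|apply_op (qop lam x) psi r| ^+ 2.
  by apply: sumr_ge0 => t _; rewrite exprn_ge0.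
rewrite paddr_eq0; last 2 first.
- by apply: sumr_ge0.
- by rewrite mulr_ge0 ?(ltW k0) //; apply: sumr_ge0.
rewrite mulf_eq0 (gt_eqF k0) /= !psumr_eq0 //.
case/andP => /allP h1 /allP h2; split=> x t hx.
- move=> tx tx2.
  have /h1/implyP : x \in index_iota 0 (n - 2) by rewrite mem_index_iota; lia.
  move=> /(_ ltac:(lia)); rewrite psumr_eq0 => [/allP/(_ t)|*]; last first.
    by rewrite mulr_ge0 ?exprn_ge0 ?ler0n.
  rewrite mem_index_enum tx tx2 mul1r sqrf_eq0 normr_eq0 => h.
  exact/eqP/h.
- have /h2/implyP : x \in index_iota 0 (n - 3) by rewrite mem_index_iota; lia.
  move=> /(_ ltac:(lia)); rewrite psumr_eq0 => [/allP/(_ t)|*]; last first.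
    by rewrite exprn_ge0.
  rewrite mem_index_enum sqrf_eq0 normr_eq0 => h.
  exact/eqP/h.
Qed.

Definition ground lam psi : Prop :=
  (forall t u b v, val t = u ++ w1b1 b ++ v -> psi t = 0) /\
  (forall t t' u v, val t = u ++ w0110 ++ v -> val t' = u ++ w1001 ++ v ->
     psi t = lam * psi t').

(** Row abcd of q_x compares a11d with 1bc1. If a or d is 1, the first word contains a 1b1; if b or
    c is 1, the second does. Given the first condition of [ground], only row 0000 carries
    information, namely the relation between 0110 and 1001. *)
Lemma in_kerP kappa lam psi : 0 < kappa ->
  in_ker kappa lam psi <-> ground lam psi.
Proof.
move=> k0; apply: (iff_trans (in_ker_local lam psi k0)).
split=> [[h1 h2]|[h1 h2]]; split.
- move=> t u b v vt.
  have : size (val t) = n by rewrite size_tuple.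
  rewrite vt !size_cat /= => sz.
  have s0 := site_cat (erefl _) vt (erefl : (0 < 3)%N).
  have s2 := site_cat (erefl _) vt (erefl : (2 < 3)%N).
  rewrite addn0 in s0.
  by apply: (h1 (size u)); rewrite ?s0 ?s2 //; lia.
- move=> t t' u v vt vt'.
  have : size (val t) = n by rewrite size_tuple.
  rewrite vt !size_cat /= => sz.
  (* Evaluate $q\psi$ on the row with 0000 in place of the pattern: raising its inner sites gives
     [t], raising its outer sites gives [t']. *)
  have sz0 : size (u ++ [:: false; false; false; false] ++ v) == n.
    by rewrite !size_cat /=; apply/eqP; lia.
  pose t0 : cfg n := Tuple sz0.
  have vt0 : val t0 = u ++ [:: false; false; false; false] ++ v by [].
  have := h2 (size u) t0 ltac:(lia); rewrite apply_qop; last by lia.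
  have s0 := site_cat (erefl _) vt0 (erefl : (0 < 4)%N).
  rewrite addn0 in s0.
  rewrite s0 !(site_cat (erefl _) vt0) //= !mul1r => /subr0_eq.
  have -> : raise (raise t0 (size u + 1)) (size u + 2) = t.
    apply: val_inj; rewrite vt.
    rewrite (@val_raise _ _ _ (u ++ [:: false; true]) false (false :: v)) //.
    - by rewrite -catA.
    - by rewrite size_cat.
    rewrite (@val_raise _ _ _ (u ++ [:: false]) false [:: false, false & v]) //.
    - by rewrite -!catA.
    - by rewrite size_cat.
    by rewrite -catA.
  have -> // : raise (raise t0 (size u)) (size u + 3) = t'.
  apply: val_inj; rewrite vt'.
  rewrite (@val_raise _ _ _ (u ++ [:: true; false; false]) false v) //.
  - by rewrite -catA.
  - by rewrite size_cat.
  rewrite (@val_raise _ _ _ u false [:: false, false, false & v]) //.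
  by rewrite -catA.
- move=> x t hx.
  have [u [w [v [su + vt]]]] := cfg_split t (ltac:(lia) : (x + 3 <= n)%N).
  case: w vt => [|a [|b [|c []]]] // vt _.
  have := site_cat su vt (erefl : (0 < 3)%N); rewrite addn0 => -> /= ea.
  rewrite (site_cat su vt) //= => ec.
  by apply: (h1 t u b v); rewrite vt ea ec.
- move=> x t hx; rewrite apply_qop //.
  have [u [w [v [su + vt]]]] := cfg_split t (ltac:(lia) : (x + 4 <= n)%N).
  case: w vt => [|a [|b [|c [|d []]]]] // vt _.
  have s0 := site_cat su vt (erefl : (0 < 4)%N).
  rewrite addn0 in s0.
  rewrite s0 !(site_cat su vt) //=.
  set t1 := raise (raise t (x + 1)) _; set t2 := raise (raise t x) _.
  have vt1 : val t1 = u ++ [:: a; true; true; d] ++ v.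
    rewrite (@val_raise _ _ _ (u ++ [:: a; true]) c (d :: v)) //.
    - by rewrite -catA.
    - by rewrite size_cat su.
    rewrite (@val_raise _ _ _ (u ++ [:: a]) b [:: c, d & v]) //.
    - by rewrite -!catA.
    - by rewrite size_cat su.
    by rewrite -catA.
  have vt2 : val t2 = u ++ [:: true; b; c; true] ++ v.
    rewrite (@val_raise _ _ _ (u ++ [:: true; b; c]) d v) //.
    - by rewrite -catA.
    - by rewrite size_cat su.
    rewrite (@val_raise _ _ _ u a [:: b, c, d & v]) //.
    by rewrite -catA.
  clearbody t1 t2.
  have z1 : a || d -> psi t1 = 0.
    case: a d {s0 vt} vt1 => [] [] //= vt1 _.
    + exact: (h1 _ u true (true :: v)).
    + exact: (h1 _ u true (false :: v)).
    + by apply: (h1 _ (u ++ [:: false]) true v); rewrite -catA.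
  have z2 : b || c -> psi t2 = 0.
    case: b c {s0 vt} vt2 => [] [] //= vt2 _.
    + exact: (h1 _ u true (true :: v)).
    + by apply: (h1 _ (u ++ [:: true]) false v); rewrite -catA.
    + exact: (h1 _ u false (true :: v)).
  rewrite -!negb_or.
  have [ad|nad] := boolP (a || d); have [bc|nbc] := boolP (b || c).
  + by rewrite z1 // z2 // !mulr0 subrr.
  + by rewrite z1 // mul0r !mulr0 subrr.
  + by rewrite z2 // mul0r !mulr0 subrr.
  + case: a b c d nad nbc vt1 vt2 {z1 z2 s0 vt} => [] [] [] [] // _ _ vt1 vt2.
    by rewrite (h2 _ _ _ _ vt1 vt2) !mul1r subrr.
Qed.

End Kernel.

(** * Amplitudes of the tiling states satisfy the local conditions *)

Section Amplitudes.
Variables (C : numClosedFieldType) (lam : C).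
Implicit Types (R D : seq tile) (s u v w : seq bool).

(** Words of arbitrary length are allowed here, so that tiles can be peeled off [R] and [s] together
    in inductions. *)
Definition amp R s : C :=
  \sum_(D <- derive R)
    lam ^+ count is_dimerlike D * ((s == tiling_content D) : nat)%:R.

Lemma psiR_amp n R (t : cfg n) : psiR n lam R t = amp R t.
Proof.
rewrite /psiR sum_ffunE; apply: eq_bigr => D _.
by rewrite !ffunE.
Qed.

(** The tensor product of the basis vector of [p] with [g], evaluated at [s]. *)
Fixpoint after (p : seq bool) (g : seq bool -> C) (s : seq bool) : C :=
  match p, s with
  | [::], _ => g s
  | a :: p', b :: s' => if a == b then after p' g s' else 0
  | _, _ => 0
  end.

Lemma after_sum (I : Type) (l : seq I) (c : I -> C) (h : I -> seq bool) p s :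
  \sum_(i <- l) c i * ((s == p ++ h i) : nat)%:R =
  after p (fun s' => \sum_(i <- l) c i * ((s' == h i) : nat)%:R) s.
Proof.
elim: p s => [|a p IH] [|b s] //=; first by rewrite big1 // => i _; rewrite mulr0.
under eq_bigr => i _ do rewrite eqseq_cons [b == a]eq_sym.
case: (a == b) => /=; first exact: IH.
by rewrite big1 // => i _; rewrite mulr0.
Qed.

Lemma sum_cons_tile t (l : seq (seq tile)) s :
  \sum_(D <- [seq t :: d | d <- l])
    lam ^+ count is_dimerlike D * ((s == tiling_content D) : nat)%:R =
  lam ^+ is_dimerlike t * after (content t) (fun s' => \sum_(D <- l)
    lam ^+ count is_dimerlike D * ((s' == tiling_content D) : nat)%:R) s.
Proof.
rewrite big_map -after_sum mulr_sumr; apply: eq_bigr => D _.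
by rewrite /= exprD mulrA.
Qed.

(** Here [R] is what follows a monomer: this is the contribution of the tilings in which that
    monomer is paired with the first tile of [R]. *)
Definition merged R s : C :=
  match R with
  | Mono :: R' => lam * after (content Dimer) (amp R') s
  | RMono1 :: R' => lam * after (content Trunc1) (amp R') s
  | RMono2 :: R' => lam * after (content Trunc2) (amp R') s
  | _ => 0
  end.

Lemma amp_nil s : amp [::] s = (s == [::])%:R.
Proof. by rewrite /amp big_seq1 mul1r. Qed.

Lemma amp_nil_cons a s : amp [::] (a :: s) = 0.
Proof. by rewrite amp_nil. Qed.

Lemma amp_nil_cat u a s : amp [::] (u ++ a :: s) = 0.
Proof. by rewrite amp_nil; case: u. Qed.

Let simp0 := (amp_nil_cons, amp_nil_cat, mulr0, mul0r, addr0, add0r).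

Lemma amp_cons t R s : amp (t :: R) s =
  lam ^+ is_dimerlike t * after (content t) (amp R) s
  + (if t is Mono then merged R s else 0).
Proof.
rewrite {1}/amp /= big_cat /= sum_cons_tile; congr (_ + _).
by case: t => //=; rewrite ?big_nil //; case: R => [|[] R] /=;
  rewrite ?big_nil // sum_cons_tile.
Qed.

(** Root tilings without left boundary dimer: this class is stable under removal of the first tile,
    as the inductions below require. *)
Fixpoint right_root R : bool :=
  match R with
  | [::] => true
  | t :: R' =>
    if is_void_or_mono t then right_root R' else is_right_last t && nilp R'
  end.

Lemma root_tilingP n R : root_tiling n R ->
  size (tiling_content R) = n /\
  (right_root R \/ exists2 R', R = LBDimer :: R' & right_root R').
Proof.
move=> [pre [mid [suf [-> [hpre [hmid [hsuf hsize]]]]]]]; split=> //.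
have rr : right_root (mid ++ suf).
  elim: mid hmid {hsize} => [_|t mid IH /= /andP[-> /IH]//].
  by case: hsuf => [->//|[[] [-> /= hl]]].
case: hpre => -> /=; first by left.
by right; exists (mid ++ suf).
Qed.

Lemma right_root_split R : right_root R -> exists mid suf,
  [/\ R = mid ++ suf, all is_void_or_mono mid &
      suf = [::] \/ exists t, suf = [:: t] /\ is_right_last t].
Proof.
elim: R => [_|t R IH /=]; first by exists [::], [::]; split=> //; left.
case: ifP => [ht /IH [mid [suf [-> hm hs]]]|_ /andP[ht /nilP ->]].
  by exists (t :: mid), suf; split=> //=; rewrite ht.
by exists [::], [:: t]; split=> //; right; exists t.
Qed.

(** Only the left boundary dimer starts with 11, and a tile starting with 1 is otherwise followed by
    a 0 or by the end of the word. *)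
Lemma amp_11 R s : right_root R -> amp R [:: true, true & s] = 0.
Proof.
case: R => [|t R]; first by rewrite amp_nil.
rewrite amp_cons; case: t => //=; rewrite ?simp0 //.
- by case: R => [|[] R] _ //=; rewrite ?simp0.
- by case: R => // _; rewrite ?simp0.
Qed.

(** No tile has two 1s at distance two, and every tile containing a 1 that is not last ends in 00,
    so the pattern cannot straddle a boundary either. The induction is on the number of tiles
    because a dimer consumes two of them. *)
Lemma amp_1b1_right R u b v : right_root R -> amp R (u ++ w1b1 b ++ v) = 0.
Proof.
elim: {R}(size R) {-2}R (leqnn (size R)) u b => [|k IH] [|t R] // hk u b rR;
  rewrite ?simp0 //.
rewrite amp_cons.
move: hk rR; rewrite /= ltnS; case: t => //= hk rR; rewrite ?addr0.
- by case: u => [|[] u] /=; rewrite ?mulr0 // IH ?mulr0.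
- rewrite -[RHS](addr0 0); congr (_ + _).
    by case: u => [|[] [|[] [|[] u]]] /=; rewrite ?IH ?simp0 //; case: b; rewrite ?simp0.
  case: R hk rR => [|[] R] //= hk rR.
  + case: u => [|[] [|[] [|[] [|[] [|[] [|[] u]]]]]] //=; rewrite ?mulr0 //;
      try by case: b; rewrite ?mulr0.
    by rewrite IH ?mulr0 //; lia.
  + case: R hk rR => // _ _.
    by case: u => [|[] [|[] [|[] [|[] u]]]]; case: b; rewrite /= ?simp0.
  + case: R hk rR => // _ _.
    by case: u => [|[] [|[] [|[] [|[] [|[] u]]]]]; case: b; rewrite /= ?simp0.
- by case: R hk rR => // _ _; case: u => [|[] [|[] [|[] u]]]; case: b; rewrite /= ?simp0.
- by case: R hk rR => // _ _; case: u => [|[] u]; rewrite /= ?simp0.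
- by case: R hk rR => // _ _; case: u => [|[] [|[] u]]; case: b; rewrite /= ?simp0.
Qed.

(** In a derived tiling 0110 arises only at the start of a dimer or truncated dimer, and 1001 only
    from a monomer followed by a monomer or a right monomer. Merging that pair is a bijection
    between the two families of tilings and costs one factor [lam]. *)
Lemma amp_move_right R u v : right_root R ->
  amp R (u ++ w0110 ++ v) = lam * amp R (u ++ w1001 ++ v).
Proof.
elim: {R}(size R) {-2}R (leqnn (size R)) u => [|k IH] [|t R] // hk u rR;
  rewrite ?simp0 //.
rewrite !amp_cons.
move: hk rR; rewrite /= ltnS; case: t => //= hk rR; rewrite ?addr0 ?mul1r.
- case: u => [|[] u] /=; rewrite ?amp_11 ?mulr0 //.
  by rewrite IH.
- have IR : forall u, amp R (u ++ w0110 ++ v)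
      = lam * amp R (u ++ w1001 ++ v) by move=> u'; apply: IH.
  have Z s : amp R [:: true, true & s] = 0 by apply: amp_11.
  case: R hk rR IR Z => [|[] R] //= hk rR IR Z; rewrite ?addr0.
  + by case: u => [|[] [|[] [|[] u]]] /=; rewrite ?simp0.
  + by case: u => [|[] [|[] [|[] u]]] /=; rewrite ?IR ?Z ?amp_cons /= ?simp0.
  (* A leading 1 excludes the dimer branch, so the second monomer stays unmerged. *)
  + have E1 s : amp (Mono :: R) (true :: s) = after [:: false; false] (amp R) s.
      by rewrite amp_cons /= mul1r; case: R {hk rR IR Z} => [|[] R] /=; rewrite ?simp0.
    case: u => [|[] [|[] [|[] u]]] /=; rewrite ?simp0 ?Z ?simp0 ?mul1r //=.
    * by rewrite E1.
    * case: u => [|[] [|[] [|[] u]]] /=; rewrite ?simp0 ?(@amp_11 R) ?simp0 //.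
      by rewrite (IH R) //; lia.
  + by case: u => [|[] [|[] [|[] u]]] /=; rewrite ?IR ?Z ?amp_cons /= ?simp0.
  + case: R hk rR IR Z => // _ _ IR Z.
    case: u => [|[] [|[] [|[] u]]] /=; rewrite ?simp0 ?Z ?simp0 ?mul1r //=.
    * by rewrite amp_cons /= !simp0 mul1r.
    * by case: u => [|[] u] /=; rewrite ?simp0.
  + case: R hk rR IR Z => // _ _ IR Z.
    case: u => [|[] [|[] [|[] u]]] /=; rewrite ?simp0 ?Z ?simp0 ?mul1r //=.
    * by rewrite amp_cons /= !simp0 mul1r.
    * by case: u => [|[] [|[] u]] /=; rewrite ?simp0.
- by case: R hk rR => // _ _; case: u => [|[] [|[] [|[] u]]]; rewrite /= ?simp0.
- by case: R hk rR => // _ _; case: u => [|[] u]; rewrite /= ?simp0.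
- by case: R hk rR => // _ _; case: u => [|[] [|[] u]]; rewrite /= ?simp0.
Qed.

Lemma amp_1b1 n R u b v : root_tiling n R -> amp R (u ++ w1b1 b ++ v) = 0.
Proof.
move=> /root_tilingP [_ [|[R' -> rR]]]; first exact: amp_1b1_right.
rewrite amp_cons addr0.
case: u => [|[] [|[] [|[] [|[] [|[] u]]]]] /=; rewrite ?amp_1b1_right ?simp0 //.
all: by case: b; rewrite ?simp0.
Qed.

(** A left boundary dimer 11000 meets neither pattern: 1001 has only two zeros between its 1s, and a
    0110 beginning at its last 0 would need a remainder starting with 11, excluded by [amp_11]. *)
Lemma amp_move n R u v : root_tiling n R ->
  amp R (u ++ w0110 ++ v) = lam * amp R (u ++ w1001 ++ v).
Proof.
move=> /root_tilingP [_ [|[R' -> rR]]]; first exact: amp_move_right.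
rewrite !amp_cons !addr0.
case: u => [|[] [|[] [|[] [|[] [|[] u]]]]] /=; rewrite ?amp_11 ?simp0 //.
by rewrite (amp_move_right _ _ rR) mulrCA.
Qed.

End Amplitudes.

(** * Words without 0110 and their root tilings *)

Section CleanWords.
Implicit Types (s u v w : seq bool) (R D : seq tile).

(** Every suffix is tested, so the disequality forbids 10011 as an ending only. The condition on the
    beginning 11001 is not hereditary and is left to [clean_root]. *)
Fixpoint clean s : bool :=
  if s isn't _ :: s' then true else
  [&& ~~ prefix (w1b1 false) s, ~~ prefix (w1b1 true) s, ~~ prefix w0110 s,
      s != [:: true; false; false; true; true] & clean s'].

Lemma clean_cons a s : clean (a :: s) =
  [&& ~~ prefix (w1b1 false) (a :: s), ~~ prefix (w1b1 true) (a :: s),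
      ~~ prefix w0110 (a :: s),
      a :: s != [:: true; false; false; true; true] & clean s].
Proof. by []. Qed.

Lemma clean_tail a s : clean (a :: s) -> clean s.
Proof. by rewrite clean_cons => /and5P[]. Qed.

Lemma not_clean s : ~~ clean s ->
  [\/ exists u b v, s = u ++ w1b1 b ++ v, exists u v, s = u ++ w0110 ++ v
    | exists u, s = u ++ [:: true; false; false; true; true]].
Proof.
elim: s => [//|a s IH].
have [/prefixP[v ->] _|p1] := boolP (prefix (w1b1 false) (a :: s)).
  by constructor 1; exists [::], false, v.
have [/prefixP[v ->] _|p2] := boolP (prefix (w1b1 true) (a :: s)).
  by constructor 1; exists [::], true, v.
have [/prefixP[v ->] _|p3] := boolP (prefix w0110 (a :: s)).
  by constructor 2; exists [::], v.
have [-> _|p4] := eqVneq (a :: s) [:: true; false; false; true; true].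
  by constructor 3; exists [::].
rewrite clean_cons p1 p2 p3 p4 => /IH.
case=> [[u [b [v ->]]]|[u [v ->]]|[u ->]].
- by constructor 1; exists (a :: u), b, v.
- by constructor 2; exists (a :: u), v.
- by constructor 3; exists (a :: u).
Qed.

Lemma clean_0110 u v : clean (u ++ w0110 ++ v) = false.
Proof.
elim: u => [|a u IH]; first by rewrite clean_cons prefix_prefix ?andbF.
by rewrite cat_cons clean_cons IH !andbF.
Qed.

Definition starts11 s := prefix [:: true; true] s.

(** Parse greedily from the left: a 1 opens a monomer, or a right monomer if the word ends too
    early, and a 0 is a void unless 11 follows. *)
Lemma clean_right_root s : clean s -> ~~ starts11 s ->
  exists2 R, right_root R & tiling_content R = s.
Proof.
elim: {s}(size s) {-2}s (leqnn (size s)) => [|k IH] [|a s] //.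
- by exists [::].
- by exists [::].
rewrite [size _]/= ltnS => hk cl ns.
have step R w : right_root R -> tiling_content R = w ->
    exists2 R', right_root R' & tiling_content R' = false :: w.
  by move=> rR <-; exists (Void :: R).
have stepM R w : right_root R -> tiling_content R = w ->
    exists2 R', right_root R' & tiling_content R' = [:: true, false, false & w].
  by move=> rR <-; exists (Mono :: R).
case: a cl ns => [|] cl ns.
- case: s hk cl ns => [|[] [|[] [|c w]]] // hk cl ns.
  + by exists [:: RMono1].
  + by exists [:: RMono2].
  + by exists [:: Mono].
  have cw : clean (c :: w) by move: cl => /clean_tail/clean_tail/clean_tail.
  (* After 100, a remainder 11 would give the ending 10011, and a longer one starting with 11 a 0110
     or a 111. *)
  have nw : ~~ starts11 (c :: w).
    by move: cl; case: c {cw hk ns} w => [] [|[] [|[] w]] //=; rewrite ?prefix0s /= ?andbF.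
  have [R rR cR] := IH (c :: w) ltac:(move: hk => /=; lia) cw nw.
  exact: stepM cR.
- have cw := clean_tail cl.
  have [s11|nw] := boolP (starts11 s); last first.
    by have [R rR cR] := IH _ hk cw nw; exact: step cR.
  (* A further letter after 011 would create 0110 or 111, so the word ends there with a right
     dimer. *)
  by case: s {hk cw ns} s11 cl => [|[] [|[] [|[] w]]] //= _;
    rewrite ?prefix0s /= ?andbF // => _; exists [:: RDimer].
Qed.

Definition clean_root s :=
  [&& clean s, ~~ prefix [:: true; true; false; false; true] s & s != w1100011].

(** A word starting with 11 must go on with 00 by the absence of 1b1, then with 0 since 11001 is
    excluded: this is the left boundary dimer. The bound on [n] discards 11, 110 and 1100. *)
Lemma clean_root_tiling n s : (5 <= n)%N -> size s = n -> clean_root s ->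
  exists2 R, root_tiling n R & tiling_content R = s.
Proof.
move=> hn hs /and3P[cl p1 p2].
have mk pre R : (pre = [::] \/ pre = [:: LBDimer]) -> right_root R ->
    tiling_content (pre ++ R) = s -> root_tiling n (pre ++ R).
  move=> hpre /right_root_split [mid [suf [eR hm hs']]] hc.
  by exists pre, mid, suf; rewrite hc eR.
have [s11|nw] := boolP (starts11 s); last first.
  have [R rR cR] := clean_right_root cl nw.
  by exists R => //; apply: (mk [::]) => //; left.
case: s s11 hs cl p1 p2 mk => [|[] [|[] [|[] [|[] [|[] w]]]]] // _ hs cl p1 p2 mk;
  try by move: hs hn => <-.
  by rewrite /= prefix0s in p1.
have cw : clean w by move: cl; do 5![move/clean_tail].
(* Otherwise the word is 1100011, or its second 11 is followed by a letter creating 0110 or 111. *)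
have nw : ~~ starts11 w.
  by move: cl p2; case: w {cw p1 mk hs} => [|[] [|[] [|[] w]]] //=;
    rewrite ?prefix0s /= ?andbF.
have [R rR cR] := clean_right_root cw nw.
exists (LBDimer :: R); last by rewrite -cR.
by apply: (mk [:: LBDimer]) => //; [right | rewrite -cR].
Qed.

(** The head of the list makes no replacement; any other choice inserts a dimer or truncated dimer,
    each starting with 0110. *)
Lemma derive_cons R : exists2 Ds, derive R = R :: Ds &
  forall D, List.In D Ds -> exists u v, tiling_content D = u ++ w0110 ++ v.
Proof.
elim: R => [|t R [Ds eDs hDs]]; first by exists [::].
rewrite /= eDs /=; eexists; first by [].
move=> D /List.in_app_iff [/List.in_map_iff [D' [<- /hDs [u [v e]]]]|].
  by exists (content t ++ u), v; rewrite /= -catA -e.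
case: t => //; case: R {eDs hDs} => [//|[]] //= R.
- by move=> /List.in_map_iff [D' [<- _]]; exists [::]; eexists.
- by move=> /List.in_map_iff [D' [<- _]]; exists [::]; eexists.
- by move=> /List.in_map_iff [D' [<- _]]; exists [::]; eexists.
Qed.

(** The word starts with 11, which forces a left boundary dimer, and the remainder 11 starts with 11
    again. *)
Lemma root_content_neq n R : root_tiling n R -> tiling_content R <> w1100011.
Proof.
have h R' : right_root R' -> forall s, tiling_content R' <> [:: true, true & s].
  by case: R' => [|[] [|t R']].
move=> /root_tilingP [_ [rR|[R' -> rR]]]; first exact: h.
by move=> [] /(h _ rR).
Qed.

(* Read in binary, with 0 and 1 exchanged; this is what decreases along the moves. *)
Fixpoint coval s : nat :=
  if s is a :: s' then ((~~ a) * 2 ^ size s' + coval s')%N else 0%N.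

Lemma coval_move u v : (coval (u ++ w1001 ++ v) < coval (u ++ w0110 ++ v))%N.
Proof.
elim: u => [|a u IH] /=; last by rewrite !size_cat /= ltn_add2l.
by rewrite !expnS; have := expn_gt0 2 (size v); lia.
Qed.

End CleanWords.

(** * Solutions of the local conditions and the tiling states *)

Section GroundSpace.
Variables (C : numClosedFieldType) (n : nat) (lam : C).
Implicit Types (psi phi : {ffun cfg n -> C}) (t : cfg n).

(** By [derive_cons] only the unmerged tiling contributes. Its power of [lam] need not be 1, since a
    left boundary dimer in [R] counts. *)
Lemma amp_clean R s : clean s ->
  amp lam R s = lam ^+ count is_dimerlike R * ((s == tiling_content R) : nat)%:R.
Proof.
move=> cl; have [Ds e hDs] := derive_cons R.
rewrite /amp e big_cons; set S := \sum_(D <- Ds) _; suff -> : S = 0 by rewrite addr0.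
rewrite /S; elim: Ds {e S} hDs => [|D Ds IH] hDs; first by rewrite big_nil.
rewrite big_cons IH ?addr0; last by move=> D' hD'; apply: hDs; right.
have [|u [v eD]] := hDs D; first by left.
case: eqP => [es|_]; last by rewrite mulr0.
by move: cl; rewrite es eD clean_0110.
Qed.

Lemma ground_psiR R : root_tiling n R -> ground lam (psiR n lam R).
Proof.
move=> rR; split=> [t u b v e|t t' u v e e']; rewrite !psiR_amp.
  by rewrite e (amp_1b1 _ _ _ _ rR).
by rewrite e e' (amp_move _ _ _ rR).
Qed.

Lemma ground0 : ground lam (0 : {ffun cfg n -> C}).
Proof. by split=> *; rewrite !ffunE ?mulr0. Qed.

Lemma groundD psi phi : ground lam psi -> ground lam phi -> ground lam (psi + phi).
Proof.
move=> [p1 p2] [q1 q2]; split=> [t u b v e|t t' u v e e']; rewrite !ffunE.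
  by rewrite (p1 _ _ _ _ e) (q1 _ _ _ _ e) addr0.
by rewrite (p2 _ _ _ _ e e') (q2 _ _ _ _ e e') mulrDr.
Qed.

Lemma ground_vscale c psi : ground lam psi -> ground lam (vscale c psi).
Proof.
move=> [p1 p2]; split=> [t u b v e|t t' u v e e']; rewrite !ffunE.
  by rewrite (p1 _ _ _ _ e) mulr0.
by rewrite (p2 _ _ _ _ e e') mulrCA.
Qed.

Lemma groundB psi phi : ground lam psi -> ground lam phi -> ground lam (psi - phi).
Proof.
move=> gp gq; have -> : - phi = vscale (-1) phi.
  by apply/ffunP => t; rewrite !ffunE mulN1r.
exact/groundD/ground_vscale.
Qed.

Lemma in_G_ground psi : in_G lam psi -> ground lam psi.
Proof.
move=> [rs [hrs ->]]; elim: rs hrs => [|p rs IH] hrs.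
  by rewrite big_nil; exact: ground0.
rewrite big_cons; apply: groundD; last by apply: IH => i; exact: (hrs i.+1).
by apply/ground_vscale/ground_psiR/(hrs 0%N).
Qed.

(** Induction on [coval], which drops along 0110 to 1001; words admitting no such move are treated
    directly. *)
Lemma ground_eq0 psi : lam != 0 -> ground lam psi ->
  (forall t, clean_root (val t) || (val t == w1100011) -> psi t = 0) -> psi = 0.
Proof.
move=> lam0 [g1 g2] gc; apply/ffunP => t; rewrite ffunE.
have mkt s t' : size s = size (val t') -> exists t'' : cfg n, val t'' = s.
  by rewrite size_tuple => /eqP hs; exists (Tuple hs).
(* If undoing a move creates a 1b1, then [lam] times the value at [t'] is zero, and [lam] is
   invertible. *)
have back t' u v : val t' = u ++ w1001 ++ v ->
    (exists u' b v', u ++ w0110 ++ v = u' ++ w1b1 b ++ v') -> psi t' = 0.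
  move=> e' [u' [b [v' e]]].
  have [|t'' et] := mkt (u ++ w0110 ++ v) t'; first by rewrite e' !size_cat.
  have := g2 _ _ _ _ et e'; rewrite (g1 t'' u' b v') ?et //.
  by move/esym/eqP; rewrite mulf_eq0 (negPf lam0) => /eqP.
elim: {t}(coval t).+1 {-2}t (ltnSn (coval t)) => // k IH t; rewrite ltnS => hk.
have [cl|/not_clean[[u [b [v e]]]|[u [v e]]|[u e]]] := boolP (clean t).
- have [/prefixP[v e]|np] := boolP (prefix [:: true; true; false; false; true] t).
    (* Undoing the move in 1(1001) gives 1(0110), which starts with 101. *)
    by apply: (back t [:: true] v e); exists [::], false, [:: true, false & v].
  by apply: gc; rewrite /clean_root cl np /= orNb.
- exact: g1 e.
- have [|t' e'] := mkt (u ++ w1001 ++ v) t; first by rewrite [val t]e !size_cat.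
  rewrite (g2 _ _ _ _ e e') IH ?mulr0 // e'.
  by apply: (leq_trans _ hk); rewrite e coval_move.
(* Undoing the move in (1001)1 gives (0110)1, which ends with 101. *)
- apply: (back t u [:: true] e).
  by exists (u ++ [:: false; true]), false, [::]; rewrite -catA.
Qed.

(** On clean words the states of the chosen root tilings are diagonal with nonzero entries, so the
    values of [psi] on the words of [clean_root] can be matched one by one. *)
Lemma ground_mod_G psi : (5 <= n)%N -> lam != 0 -> ground lam psi ->
  exists phi, [/\ in_G lam phi, ground lam (psi - phi) &
    forall t, clean_root (val t) -> (psi - phi) t = 0].
Proof.
move=> hn lam0 gpsi.
have hR (t : cfg n) : exists R, clean_root (val t) ->
    root_tiling n R /\ tiling_content R = val t.
  have [ct|_] := boolP (clean_root (val t)); last by exists [::].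
  by have [R] := clean_root_tiling hn (size_tuple t) ct; exists R.
have [R {}hR] := fin_all_exists hR.
(* The divisor is the amplitude of the state of [R t] at [t] itself, by [amp_clean]. *)
pose coef (t : cfg n) : C := psi t / lam ^+ count is_dimerlike (R t).
pose phi := \sum_(t | clean_root (val t)) vscale (coef t) (psiR n lam (R t)).
have Gphi : in_G lam phi.
  exists [seq (coef t, R t) | t <- enum [pred t : cfg n | clean_root (val t)]].
  split=> [i|]; last by rewrite big_map big_enum.
  rewrite size_map => hi; set r := enum _ in hi *.
  have t0 : cfg n by case: r hi => [|t].
  rewrite (nth_map t0) //=; have /(mem_nth t0) := hi.
  by rewrite mem_enum => /hR[].
exists phi; split=> // [|t ct]; first exact/groundB/in_G_ground.
have cl (s : cfg n) : clean_root s -> clean s by case/and3P.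
rewrite !ffunE sum_ffunE (bigD1 t) //= big1 ?addr0 => [|s /andP[cs /negPf st]].
  rewrite ffunE psiR_amp amp_clean ?cl // (hR t ct).2 eqxx mulr1.
  by rewrite /coef divfK ?subrr // expf_neq0.
rewrite ffunE psiR_amp amp_clean ?cl // (hR s cs).2 val_eqE eq_sym st.
by rewrite !mulr0.
Qed.

Lemma in_G_1100011 psi t : in_G lam psi -> val t = w1100011 -> psi t = 0.
Proof.
move=> [rs [hrs ->]] et; elim: rs hrs => [|p rs IH] hrs.
  by rewrite big_nil ffunE.
rewrite big_cons !ffunE IH ?addr0; last by move=> i; exact: (hrs i.+1).
rewrite psiR_amp et amp_clean //.
by have /root_content_neq/eqP/negPf := hrs 0%N erefl; rewrite eq_sym => ->; rewrite !mulr0.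
Qed.

(** The word contains none of 1b1, 0110 and 1001, so both conditions hold trivially. *)
Lemma ground_ket_1100011 : ground lam (ket C n w1100011).
Proof.
have no1 u b v : (u ++ w1b1 b ++ v == w1100011) = false.
  by case: u => [|[] [|[] [|[] [|[] [|[] [|[] [|[] [|? ?]]]]]]]]; case: b.
have no2 u v : (u ++ w0110 ++ v == w1100011) = false.
  by case: u => [|[] [|[] [|[] [|[] [|[] [|[] [|[] [|? ?]]]]]]]].
have no3 u v : (u ++ w1001 ++ v == w1100011) = false.
  by case: u => [|[] [|[] [|[] [|[] [|[] [|[] [|[] [|? ?]]]]]]]].
split=> [t u b v e|t t' u v e e']; rewrite !ffunE; first by rewrite e no1.
by rewrite e e' no2 no3 mulr0.
Qed.

End GroundSpace.

(** * The kernel for the various lengths *)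

Theorem theorem2p15 (C : numClosedFieldType) (kappa lam : C) :
  0 < kappa -> lam != 0 ->
  (forall n : nat, (8 <= n)%N \/ n = 5%N \/ n = 6%N ->
     forall psi : {ffun cfg n -> C}, in_ker kappa lam psi <-> in_G lam psi) /\
  ((forall psi : {ffun cfg 7 -> C},
      in_ker kappa lam psi <->
      exists phi c, in_G lam phi /\
        psi = phi + vscale c (ket C 7 [:: true; true; false; false; false; true; true])) /\
   (forall c : C,
      in_G lam (vscale c (ket C 7 [:: true; true; false; false; false; true; true])) -> c = 0)).
Proof.
move=> k0 lam0; split=> [n hn psi|]; last split=> [psi|c hc].
- rewrite (in_kerP _ _ k0); split=> [gpsi|]; last exact: in_G_ground.
  have [|phi [Gphi gd hd]] := ground_mod_G _ lam0 gpsi; first by lia.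
  suff /eqP : psi - phi = 0 by rewrite subr_eq0 => /eqP ->.
  apply: (ground_eq0 lam0 gd) => t /orP[/hd//|/eqP et].
  (* The exceptional word has length 7, which [hn] excludes. *)
  by have := size_tuple t; rewrite [tval t]et /= => en; lia.
- rewrite (in_kerP _ _ k0).
  split=> [gpsi|[phi [c [Gphi ->]]]]; last first.
    apply: groundD; first exact: in_G_ground.
    exact/ground_vscale/ground_ket_1100011.
  have [//|phi [Gphi gd hd]] := ground_mod_G _ lam0 gpsi.
  (* After subtracting [phi], the value at 1100011 is the only one left to cancel before
     [ground_eq0] applies. *)
  pose c := (psi - phi) [tuple of w1100011].
  exists phi, c; split=> //; apply/eqP; rewrite addrC -subr_eq -subr_eq0; apply/eqP.
  apply: (ground_eq0 lam0) => [|t /orP[ct|/eqP et]].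
  + exact/groundB/ground_vscale/ground_ket_1100011.
  + rewrite ffunE hd // !ffunE.
    by case/and3P: ct => _ _ /negPf ->; rewrite mulr0 subrr.
  + have -> : t = [tuple of w1100011] by apply: val_inj.
    by rewrite !ffunE /= mulr1 /c !ffunE subrr.
(* The sum is direct because every element of the span vanishes at 1100011. *)
- have := in_G_1100011 hc (erefl : val [tuple of w1100011] = w1100011).
  by rewrite !ffunE /= mulr1.
Qed.
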